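(* Let $n\ge 1$ be an integer and let $\mathcal{S}_n$ be the Schrödinger algebra in $(n+1)$-dimensional space-time. Every $\frac12$-derivation $\varphi$ of $\mathcal{S}_n$ is of the form $$\varphi=\theta\,\mathrm{id}_{\mathcal{S}_n}+\delta_{2n}\,\beta\,\Re$$ for some $\theta,\beta\in\mathbb{C}$. In other words, $$\triangle(\mathcal{S}_n)=\mathrm{Span}_{\mathbb{C}}\{\mathrm{id}_{\mathcal{S}_n},\ \delta_{2n}\Re\},$$ so that $\dim\triangle(\mathcal{S}_n)=1$ if $n\neq 2$ and $\dim\triangle(\mathcal{S}_2)=2$. Here $\delta_{2n}$ is the Kronecker delta, $\Re$ is the linear map on $\mathcal{S}_2$ with $\Re(s_{12})=z$ and $\Re(u)=0$ for $u\in\{f,h,e,z,x_1,y_1,x_2,y_2\}$, and $\delta_{2n}\Re$ is understood as the zero map when $n\ne 2$.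
   Context: For an integer $n\ge1$, the Schrödinger algebra $\mathcal{S}_n$ is the complex Lie algebra with basis $\{e,f,h,z,x_i,y_i,s_{jk}\mid 1\le i\le n,\ 1\le j<k\le n\}$, with the convention $s_{kj}=-s_{jk}$ (so $s_{jj}=0$), and brackets $[e,f]=h$, $[h,e]=2e$, $[f,h]=2f$, $[x_i,y_i]=z$, $[h,x_i]=x_i$, $[h,y_i]=-y_i$, $[e,y_i]=x_i$, $[f,x_i]=y_i$, $[s_{jk},x_i]=\delta_{ki}x_j-\delta_{ji}x_k$, $[s_{jk},y_i]=\delta_{ki}y_j-\delta_{ji}y_k$, $[s_{jk},s_{lm}]=\delta_{lk}s_{jm}+\delta_{jm}s_{kl}+\delta_{mk}s_{lj}+\delta_{lj}s_{mk}$, where $\delta$ is the Kronecker delta; all brackets of basis elements not determined by these relations and antisymmetry are zero. (For $n=1$ there are no elements $s_{jk}$.) A $\frac12$-derivation of a Lie algebra $(\mathcal{L},[\cdot,\cdot])$ is a linear map $\varphi:\mathcal{L}\to\mathcal{L}$ with $\varphi([x,y])=\frac12\big([\varphi(x),y]+[x,\varphi(y)]\big)$ for all $x,y\in\mathcal{L}$. $\triangle(\mathcal{L})$ denotes the vector space of all $\frac12$-derivations of $\mathcal{L}$. *)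

(* Defs.v *)
From HB Require Import structures.
From mathcomp Require Import all_boot all_order all_algebra.
From mathcomp Require Import ring.

Set Implicit Arguments.
Unset Strict Implicit.
Unset Printing Implicit Defensive.

Import GRing.Theory.
Local Open Scope ring_scope.

HB.mixin Record isLieAlgebra (K : fieldType) L of Vector K L := {
  lie : L -> L -> L;
  lie_linearl : forall v, linear (fun u => lie u v);
  lie_linearr : forall u, linear (lie u);
  liexx : forall u, lie u u = 0;
  lie_jacobi : forall u v w,
    lie u (lie v w) + lie v (lie w u) + lie w (lie u v) = 0
}.

#[short(type="lieAlgebraType")]
HB.structure Definition LieAlgebra (K : fieldType) :=
  { L of isLieAlgebra K L & Vector K L }.

Definition half_derivation (K : fieldType) (L : lieAlgebraType K)
    (phi : 'End(L)) : Prop :=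
  forall u v : L, phi (lie u v) = 2^-1 *: (lie (phi u) v + lie u (phi v)).

Definition half_defect (K : fieldType) (L : lieAlgebraType K) (u v : L)
    (phi : 'End(L)) : L :=
  phi (lie u v) - 2^-1 *: (lie (phi u) v + lie u (phi v)).

Fact half_defect_linear (K : fieldType) (L : lieAlgebraType K) (u v : L) :
  linear (half_defect u v).
Proof.
move=> c phi psi; rewrite /half_defect !add_lfunE !scale_lfunE.
rewrite lie_linearl lie_linearr [X in 2^-1 *: X]addrACA -scalerDr.
rewrite [2^-1 *: (_ + _)]scalerDr scalerA mulrC -scalerA opprD addrACA.
by rewrite -scalerBr.
Qed.

HB.instance Definition _ (K : fieldType) (L : lieAlgebraType K) (u v : L) :=
  GRing.isLinear.Build K 'End(L) L *:%R (half_defect u v)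
    (half_defect_linear u v).

(* A subspace of type {vspace _} must be given by finitely many equations, so
   the condition is imposed on pairs of basis vectors; half_derivationsP shows
   that this is the space of all 1/2-derivations. *)
Definition half_derivations (K : fieldType) (L : lieAlgebraType K) :
    {vspace 'End(L)} :=
  (\bigcap_(i < \dim {:L}) \bigcap_(j < \dim {:L})
     lker (linfun (half_defect (vbasis {:L})`_i (vbasis {:L})`_j)))%VS.

Lemma memv_bigcapP (K : fieldType) (V : vectType K) (I : finType)
    (U : I -> {vspace V}) (v : V) :
  reflect (forall i, v \in U i) (v \in \bigcap_i U i)%VS.
Proof.
rewrite memvE; apply: (iffP subv_bigcapP) => h i.
  by rewrite memvE; apply: h.
by move=> _; rewrite -memvE.
Qed.

Lemma half_derivationsP (K : fieldType) (L : lieAlgebraType K)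
    (phi : 'End(L)) :
  reflect (half_derivation phi) (phi \in half_derivations L).
Proof.
apply: (iffP (memv_bigcapP _ _)) => [h u v|h i]; last first.
  apply/memv_bigcapP => j; rewrite memv_ker lfunE /= /half_defect h.
  by rewrite subrr.
have hb i j : half_defect (vbasis {:L})`_i (vbasis {:L})`_j phi = 0
    :> L \/ ~ (i < \dim {:L} /\ j < \dim {:L})%N.
  case: (ltnP i (\dim {:L})) => hi; last by right=> -[].
  case: (ltnP j (\dim {:L})) => hj; last by right=> -[].
  left; move/memv_bigcapP/(_ (Ordinal hj)): (h (Ordinal hi)).
  by rewrite memv_ker lfunE /= => /eqP.
have dl w : linear (fun u => half_defect u w phi).
  move=> c x y; rewrite /half_defect lie_linearl !linearP lie_linearl.
  rewrite lie_linearl [X in 2^-1 *: X]addrACA -scalerDr.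
  rewrite [2^-1 *: (_ + _)]scalerDr scalerA mulrC -scalerA opprD addrACA.
  by rewrite -scalerBr.
have dr w : linear (fun v => half_defect w v phi).
  move=> c x y; rewrite /half_defect lie_linearr !linearP lie_linearr.
  rewrite lie_linearr [X in 2^-1 *: X]addrACA -scalerDr.
  rewrite [2^-1 *: (_ + _)]scalerDr scalerA mulrC -scalerA opprD addrACA.
  by rewrite -scalerBr.
suff: half_defect u v phi = 0 by move/eqP; rewrite subr_eq0 => /eqP.
pose fl w := GRing.isLinear.Build K L L *:%R _ (dl w).
pose fr w := GRing.isLinear.Build K L L *:%R _ (dr w).
pose Fl w : {linear L -> L} := HB.pack (fun u => half_defect u w phi) (fl w).
pose Fr w : {linear L -> L} := HB.pack (fun v => half_defect w v phi) (fr w).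
rewrite (coord_vbasis (memvf u)).
rewrite -[LHS]/(Fl v _) linear_sum big1 // => i _; rewrite linearZ /=.
rewrite (coord_vbasis (memvf v)).
rewrite -[X in _ *: X]/(Fr _ _) linear_sum big1 ?scaler0 // => j _.
by rewrite linearZ /=; case: (hb i j) => [->|[]]; rewrite ?scaler0.
Qed.

Inductive schro_idx (n : nat) : Type :=
  | Ie | If | Ih | Iz
  | Ix of 'I_n
  | Iy of 'I_n
  | Is of {p : 'I_n * 'I_n | (p.1 < p.2)%N}.

Arguments Ie {n}.
Arguments If {n}.
Arguments Ih {n}.
Arguments Iz {n}.

Definition schro_idx_code (n : nat) (a : schro_idx n) :
    'I_4 + ('I_n + 'I_n) + {p : 'I_n * 'I_n | (p.1 < p.2)%N} :=
  match a with
  | Ie => inl (inl (inord 0))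
  | If => inl (inl (inord 1))
  | Ih => inl (inl (inord 2))
  | Iz => inl (inl (inord 3))
  | Ix i => inl (inr (inl i))
  | Iy i => inl (inr (inr i))
  | Is p => inr p
  end.

Definition schro_idx_decode (n : nat)
    (c : 'I_4 + ('I_n + 'I_n) + {p : 'I_n * 'I_n | (p.1 < p.2)%N}) :
    schro_idx n :=
  match c with
  | inl (inl k) => nth Iz [:: Ie; If; Ih; Iz] k
  | inl (inr (inl i)) => Ix i
  | inl (inr (inr i)) => Iy i
  | inr p => Is p
  end.

Lemma schro_idx_codeK (n : nat) :
  cancel (@schro_idx_code n) (@schro_idx_decode n).
Proof. by case=> //=; rewrite inordK. Qed.

HB.instance Definition _ (n : nat) :=
  Finite.copy (schro_idx n) (can_type (@schro_idx_codeK n)).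

Definition schrodinger (K : fieldType) (n : nat) : Type :=
  {ffun schro_idx n -> K^o}.

HB.instance Definition _ (K : fieldType) (n : nat) :=
  Vector.on (schrodinger K n).

Definition schro_basis (K : fieldType) (n : nat) (a : schro_idx n) :
    schrodinger K n :=
  [ffun b => (b == a)%:R].

Section Generators.
Variables (K : fieldType) (n : nat).

Definition schro_e : schrodinger K n := schro_basis K Ie.
Definition schro_f : schrodinger K n := schro_basis K If.
Definition schro_h : schrodinger K n := schro_basis K Ih.
Definition schro_z : schrodinger K n := schro_basis K Iz.
Definition schro_x (i : 'I_n) : schrodinger K n := schro_basis K (Ix i).
Definition schro_y (i : 'I_n) : schrodinger K n := schro_basis K (Iy i).

(* s_jk for arbitrary j, k, with s_kj = - s_jk and s_jj = 0. *)
Definition schro_s (j k : 'I_n) : schrodinger K n :=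
  if insub (j, k) is Some p then schro_basis K (Is p)
  else if insub (k, j) is Some p then - schro_basis K (Is p)
  else 0.

End Generators.

Arguments schro_e {K n}.
Arguments schro_f {K n}.
Arguments schro_h {K n}.
Arguments schro_z {K n}.
Arguments schro_x {K n} i.
Arguments schro_y {K n} i.
Arguments schro_s {K n} j k.

Definition kron (K : fieldType) (n : nat) (i j : 'I_n) : K := (i == j)%:R.
Arguments kron K {n} i j.

Definition schro_table (K : fieldType) (n : nat) (a b : schro_idx n) :
    schrodinger K n :=
  match a, b with
  | Ie, If => schro_h
  | If, Ie => - schro_h
  | Ih, Ie => 2 *: schro_e
  | Ie, Ih => - (2 *: schro_e)
  | If, Ih => 2 *: schro_f
  | Ih, If => - (2 *: schro_f)
  | Ix i, Iy j => kron K i j *: schro_z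
  | Iy j, Ix i => - (kron K i j *: schro_z)
  | Ih, Ix i => schro_x i
  | Ix i, Ih => - schro_x i
  | Ih, Iy i => - schro_y i
  | Iy i, Ih => schro_y i
  | Ie, Iy i => schro_x i
  | Iy i, Ie => - schro_x i
  | If, Ix i => schro_y i
  | Ix i, If => - schro_y i
  | Is (exist (j, k) _), Ix i =>
      kron K k i *: schro_x j - kron K j i *: schro_x k
  | Ix i, Is (exist (j, k) _) =>
      - (kron K k i *: schro_x j - kron K j i *: schro_x k)
  | Is (exist (j, k) _), Iy i =>
      kron K k i *: schro_y j - kron K j i *: schro_y k
  | Iy i, Is (exist (j, k) _) =>
      - (kron K k i *: schro_y j - kron K j i *: schro_y k)
  | Is (exist (j, k) _), Is (exist (l, m) _) =>
      kron K l k *: schro_s j m + kron K j m *: schro_s k l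
      + kron K m k *: schro_s l j + kron K l j *: schro_s m k
  | _, _ => 0
  end.

Definition schro_lie (K : fieldType) (n : nat) (u v : schrodinger K n) :
    schrodinger K n :=
  \sum_a \sum_b (u a * v b) *: schro_table K a b.

(* The Jacobi identity is computed on generators kept as variables, so that
   rewriting never unfolds the sign convention of schro_s. *)
Section JacobiOnGenerators.
Variables (K : fieldType) (L : lmodType K) (I : Type).
Variables (d : I -> I -> K) (br : L -> L -> L).
Variables (e f h z : L) (x y : I -> L) (s : I -> I -> L).

Inductive schro_gen := Ge | Gf | Gh | Gz | Gx of I | Gy of I | Gs of I & I.

Definition schro_gen_val (g : schro_gen) : L :=
  match g with
  | Ge => e | Gf => f | Gh => h | Gz => z
  | Gx i => x i | Gy i => y i | Gs j k => s j k
  end.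

Definition schro_gen_br (g g' : schro_gen) : L :=
  match g, g' with
  | Ge, Gf => h | Gf, Ge => - h
  | Gh, Ge => 2 *: e | Ge, Gh => - (2 *: e)
  | Gf, Gh => 2 *: f | Gh, Gf => - (2 *: f)
  | Gx i, Gy j => d i j *: z | Gy j, Gx i => - (d i j *: z)
  | Gh, Gx i => x i | Gx i, Gh => - x i
  | Gh, Gy i => - y i | Gy i, Gh => y i
  | Ge, Gy i => x i | Gy i, Ge => - x i
  | Gf, Gx i => y i | Gx i, Gf => - y i
  | Gs j k, Gx i => d k i *: x j - d j i *: x k
  | Gx i, Gs j k => - (d k i *: x j - d j i *: x k)
  | Gs j k, Gy i => d k i *: y j - d j i *: y k
  | Gy i, Gs j k => - (d k i *: y j - d j i *: y k)
  | Gs j k, Gs l m =>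
      d l k *: s j m + d j m *: s k l + d m k *: s l j + d l j *: s m k
  | _, _ => 0
  end.

Hypothesis dC : forall i j, d i j = d j i.
Hypothesis sC : forall i j, s j i = - s i j.
Hypothesis brD : forall u v w, br u (v + w) = br u v + br u w.
Hypothesis brZ : forall c u v, br u (c *: v) = c *: br u v.
Hypothesis brE : forall g g',
  br (schro_gen_val g) (schro_gen_val g') = schro_gen_br g g'.

Let brN u v : br u (- v) = - br u v.
Proof. by rewrite -scaleN1r brZ scaleN1r. Qed.
Let br0 u : br u 0 = 0.
Proof. by have := brZ 0 u 0; rewrite !scale0r. Qed.

Definition gen_row (u : L) (g : schro_gen) :=
  ((br u e = schro_gen_br g Ge) * (br u f = schro_gen_br g Gf)
   * (br u h = schro_gen_br g Gh) * (br u z = schro_gen_br g Gz)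
   * (forall i, br u (x i) = schro_gen_br g (Gx i))
   * (forall i, br u (y i) = schro_gen_br g (Gy i))
   * (forall j k, br u (s j k) = schro_gen_br g (Gs j k)))%type.

Let rowP g : gen_row (schro_gen_val g) g.
Proof.
split; [split; [split; [split; [split; [split|]|]|]|]|].
- exact: (brE g Ge).
- exact: (brE g Gf).
- exact: (brE g Gh).
- exact: (brE g Gz).
- by move=> i; exact: (brE g (Gx i)).
- by move=> i; exact: (brE g (Gy i)).
- by move=> j k; exact: (brE g (Gs j k)).
Qed.

Definition schro_jac u v w := br u (br v w) + br v (br w u) + br w (br u v).

Let rank g := match g with
  Ge => 0%N | Gf => 1%N | Gh => 2%N | Gz => 3%N
  | Gx _ => 4%N | Gy _ => 5%N | Gs _ _ => 6%N end.

Let jac_sorted g1 g2 g3 (ev : L -> K) :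
  (forall u v, ev (u + v) = ev u + ev v) ->
  (forall c u, ev (c *: u) = c * ev u) ->
  (rank g1 <= rank g2 <= rank g3)%N ->
  ev (schro_jac (schro_gen_val g1) (schro_gen_val g2) (schro_gen_val g3)) = 0.
Proof.
move=> evD evZ.
have evN u : ev (- u) = - ev u by rewrite -scaleN1r evZ mulN1r.
have ev0 : ev 0 = 0 by have := evZ 0 0; rewrite scale0r mul0r.
have re := rowP Ge; have rf := rowP Gf; have rh := rowP Gh; have rz := rowP Gz.
have rx i := rowP (Gx i); have ry i := rowP (Gy i).
have rs j k := rowP (Gs j k).
rewrite /schro_jac !brE.
case: g3 => [||||k|k|k k']; case: g2 => [||||j|j|j j'] //;
 case: g1 => [||||i|i|i i'] // _; rewrite /schro_gen_br /= ?(brD, brN, brZ, br0).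
all: rewrite ?(re, rf, rh, rz, rx, ry, rs) /schro_gen_br ?(evD, evN, evZ, ev0).
all: try ring.
- by rewrite (dC k j); ring.
- by rewrite (dC k j); ring.
- by rewrite (dC i k) (dC i k'); ring.
- by rewrite (dC k j) (dC k j') (dC k' j') (dC j k'); ring.
- by rewrite (dC k j) (dC k j') (dC k' j') (dC j k'); ring.
- rewrite ?(dC i' i) ?(dC j i) ?(dC j i') ?(dC j' i) ?(dC j' i').
  rewrite ?(dC j' j) ?(dC k i) ?(dC k i') ?(dC k j) ?(dC k j').
  rewrite ?(dC k' i) ?(dC k' i') ?(dC k' j) ?(dC k' j') ?(dC k' k).
  rewrite ?(sC i i') ?(sC i j) ?(sC i' j) ?(sC i j') ?(sC i' j').
  rewrite ?(sC j j') ?(sC i k) ?(sC i' k) ?(sC j k) ?(sC j' k).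
  rewrite ?(sC i k') ?(sC i' k') ?(sC j k') ?(sC j' k') ?(sC k k') ?evN.
  by ring.
Qed.

Let jacC u v w : (forall u v, br u v = - br v u) ->
  schro_jac v u w = - schro_jac u v w.
Proof.
move=> brC; rewrite /schro_jac (brC w v) (brC w u) (brC v u) !brN.
by rewrite !opprD !opprK [X in X + _ = _]addrC.
Qed.

Let jacR u v w : schro_jac v w u = schro_jac u v w.
Proof. by rewrite /schro_jac addrC addrA. Qed.

Lemma schro_gen_jacobi g1 g2 g3 (ev : L -> K) :
  (forall u v, br u v = - br v u) ->
  (forall u v, ev (u + v) = ev u + ev v) ->
  (forall c u, ev (c *: u) = c * ev u) ->
  ev (schro_jac (schro_gen_val g1) (schro_gen_val g2) (schro_gen_val g3)) = 0.
Proof.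
move=> brC evD evZ.
have evN u : ev (- u) = - ev u by rewrite -scaleN1r evZ mulN1r.
wlog le12 : g1 g2 / (rank g1 <= rank g2)%N => [hw|].
  case/orP: (leq_total (rank g1) (rank g2)) => [/hw //|/hw h12].
  by rewrite jacC // evN h12 oppr0.
case: (leqP (rank g2) (rank g3)) => [le23|/ltnW le32].
  by apply: jac_sorted => //; rewrite le12.
case: (leqP (rank g1) (rank g3)) => [le13|/ltnW le31].
  by rewrite -jacR jacC // jacR evN jac_sorted ?oppr0 // le13.
by rewrite jacR jac_sorted // le31.
Qed.

End JacobiOnGenerators.

Section SchrodingerLie.
Variables (K : fieldType) (n : nat).
Implicit Types (u v w : schrodinger K n) (a b c : schro_idx n).
Implicit Types (i j k l m : 'I_n).

Lemma schro_sumE u : u = \sum_a u a *: schro_basis K a.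
Proof.
apply/ffunP => b; rewrite sum_ffunE (bigD1 b) //= !ffunE eqxx.
rewrite [_ *: _]mulr1 big1 ?addr0 // => a /negPf nab.
by rewrite !ffunE eq_sym nab scaler0.
Qed.

Lemma schro_lie_linearl v : linear (fun u => schro_lie u v).
Proof.
move=> c u u'; rewrite /schro_lie scaler_sumr -big_split /=.
apply: eq_bigr => a _; rewrite scaler_sumr -big_split /=.
apply: eq_bigr => b _; rewrite scalerA -scalerDl !ffunE mulrDl.
by rewrite -[_ *: u a]/(c * u a) mulrA.
Qed.

Lemma schro_lie_linearr u : linear (schro_lie u).
Proof.
move=> c v v'; rewrite /schro_lie scaler_sumr -big_split /=.
apply: eq_bigr => a _; rewrite scaler_sumr -big_split /=.
apply: eq_bigr => b _; rewrite scalerA -scalerDl !ffunE mulrDr.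
by rewrite -[_ *: v b]/(c * v b) mulrCA.
Qed.

Lemma schro_lie_basis a b :
  schro_lie (schro_basis K a) (schro_basis K b) = schro_table K a b.
Proof.
rewrite /schro_lie (bigD1 a) //= (bigD1 b) //= !ffunE !eqxx mulr1 scale1r.
rewrite big1 => [|b' /negPf nb]; last by rewrite !ffunE nb mulr0 scale0r.
rewrite big1 ?addr0 // => a' /negPf na.
by rewrite big1 // => b' _; rewrite !ffunE na mul0r scale0r.
Qed.

Lemma schro_lieDl v u u' :
  schro_lie (u + u') v = schro_lie u v + schro_lie u' v.
Proof. by have := schro_lie_linearl v 1 u u'; rewrite !scale1r. Qed.
Lemma schro_lieDr v u u' :
  schro_lie v (u + u') = schro_lie v u + schro_lie v u'.
Proof. by have := schro_lie_linearr v 1 u u'; rewrite !scale1r. Qed.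
Lemma schro_lie0l v : schro_lie 0 v = 0.
Proof. by apply: (addIr (schro_lie 0 v)); rewrite -schro_lieDl !add0r. Qed.
Lemma schro_lie0r v : schro_lie v 0 = 0.
Proof. by apply: (addIr (schro_lie v 0)); rewrite -schro_lieDr !add0r. Qed.
Lemma schro_lieZl v (c : K) u : schro_lie (c *: u) v = c *: schro_lie u v.
Proof.
by have := schro_lie_linearl v c u 0; rewrite !addr0 schro_lie0l addr0.
Qed.
Lemma schro_lieZr v (c : K) u : schro_lie v (c *: u) = c *: schro_lie v u.
Proof.
by have := schro_lie_linearr v c u 0; rewrite !addr0 schro_lie0r addr0.
Qed.
Lemma schro_lieNl v u : schro_lie (- u) v = - schro_lie u v.
Proof. by rewrite -scaleN1r schro_lieZl scaleN1r. Qed.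
Lemma schro_lieNr v u : schro_lie v (- u) = - schro_lie v u.
Proof. by rewrite -scaleN1r schro_lieZr scaleN1r. Qed.

Lemma schro_lt_s j k (h : (j < k)%N) :
  schro_basis K (Is (exist _ (j, k) h)) = schro_s j k.
Proof.
rewrite /schro_s; case: insubP => [p _ pE|]; last by rewrite /= h.
by congr (schro_basis K (Is _)); apply: val_inj.
Qed.

Lemma schro_sC j k : schro_s k j = - schro_s j k :> schrodinger K n.
Proof.
rewrite /schro_s; case: insubP => [p hp pE|hp];
  case: insubP => [q hq qE|hq]; rewrite ?opprK ?oppr0 //.
by move: (ltn_trans hp hq); rewrite ltnn.
Qed.

Lemma schro_sjj j : schro_s j j = 0 :> schrodinger K n.
Proof. by rewrite /schro_s; case: insubP => // p; rewrite /= ltnn. Qed.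

Lemma kronC i j : kron K i j = kron K j i.
Proof. by rewrite /kron eq_sym. Qed.

Lemma schro_s_cases (P : schrodinger K n -> 'I_n -> 'I_n -> Prop) :
  (forall j k (h : (j < k)%N), P (schro_basis K (Is (exist _ (j, k) h))) j k) ->
  (forall u j k, P u j k -> P (- u) k j) -> (forall j, P 0 j j) ->
  forall j k, P (schro_s j k) j k.
Proof.
move=> Pb PN P0 j k; case: (ltngtP j k) => [h|h|/val_inj->].
- by rewrite -(schro_lt_s h).
- by rewrite schro_sC -(schro_lt_s h); apply: PN.
- by rewrite schro_sjj.
Qed.

Lemma schro_lie_sx j k i :
  schro_lie (schro_s j k) (schro_x i)
  = kron K k i *: schro_x j - kron K j i *: schro_x k.
Proof.
move: j k; apply: (schro_s_cases (P := fun u j k => schro_lie u (schro_x i)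
  = kron K k i *: schro_x j - kron K j i *: schro_x k)) => [j k h|u j k|j].
- by rewrite schro_lie_basis.
- by rewrite schro_lieNl => ->; rewrite opprB.
- by rewrite schro_lie0l subrr.
Qed.

Lemma schro_lie_sy j k i :
  schro_lie (schro_s j k) (schro_y i)
  = kron K k i *: schro_y j - kron K j i *: schro_y k.
Proof.
move: j k; apply: (schro_s_cases (P := fun u j k => schro_lie u (schro_y i)
  = kron K k i *: schro_y j - kron K j i *: schro_y k)) => [j k h|u j k|j].
- by rewrite schro_lie_basis.
- by rewrite schro_lieNl => ->; rewrite opprB.
- by rewrite schro_lie0l subrr.
Qed.


Lemma schro_evalP u v : (forall a, u a = v a :> K) -> u = v.
Proof. by move=> h; apply/ffunP. Qed.
Lemma schro_evalD a u v : (u + v) a = u a + v a :> K.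
Proof. by rewrite ffunE. Qed.
Lemma schro_evalN a u : (- u) a = - u a :> K.
Proof. by rewrite ffunE. Qed.
Lemma schro_evalZ a (c : K) u : (c *: u) a = c * u a :> K.
Proof. by rewrite ffunE. Qed.
Lemma schro_eval0 a : (0 : schrodinger K n) a = 0 :> K.
Proof. by rewrite ffunE. Qed.
Definition schro_evalE :=
  (schro_evalD, schro_evalN, schro_evalZ, schro_eval0).

Lemma schro_lie_ss j k l m :
  schro_lie (schro_s j k) (schro_s l m)
  = kron K l k *: schro_s j m + kron K j m *: schro_s k l
    + kron K m k *: schro_s l j + kron K l j *: schro_s m k.
Proof.
pose F j k l m : schrodinger K n :=
  kron K l k *: schro_s j m + kron K j m *: schro_s k l
  + kron K m k *: schro_s l j + kron K l j *: schro_s m k.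
have FNl j' k' l' m' : F k' j' l' m' = - F j' k' l' m'.
  rewrite /F [kron K k' m']kronC [kron K j' m']kronC.
  rewrite (schro_sC j' m') (schro_sC k' l') (schro_sC l' j') (schro_sC m' k').
  by apply: schro_evalP => a; rewrite !schro_evalE; ring.
have FNr j' k' l' m' : F j' k' m' l' = - F j' k' l' m'.
  rewrite /F [kron K j' l']kronC [kron K m' j']kronC.
  rewrite (schro_sC j' m') (schro_sC k' l') (schro_sC l' j') (schro_sC m' k').
  by apply: schro_evalP => a; rewrite !schro_evalE; ring.
have F0l j' l' m' : F j' j' l' m' = 0.
  rewrite /F (schro_sC l' j') (schro_sC m' j') [kron K j' m']kronC.
  by apply: schro_evalP => a; rewrite !schro_evalE; ring.
have F0r j' l' m' : F l' m' j' j' = 0.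
  rewrite /F (schro_sC l' j') (schro_sC m' j') [kron K l' j']kronC.
  by apply: schro_evalP => a; rewrite !schro_evalE; ring.
rewrite -/(F j k l m).
move: j k; apply: (schro_s_cases
  (P := fun u j k => schro_lie u (schro_s l m) = F j k l m)).
- move=> j k h; move: l m; apply: (schro_s_cases (P := fun u l m =>
    schro_lie (schro_basis K (Is (exist _ (j, k) h))) u = F j k l m)).
  + by move=> l m h'; exact: schro_lie_basis.
  + by move=> u l m hu; rewrite schro_lieNr hu -FNr.
  + by move=> l; rewrite schro_lie0r F0r.
- by move=> u j k hu; rewrite schro_lieNl hu -FNl.
- by move=> j; rewrite schro_lie0l F0l.
Qed.

Lemma schro_tableC a b : schro_table K a b = - schro_table K b a.
Proof.
case: a b => [||||i|i|[[j k] h]] [||||i'|i'|[[j' k'] h']];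
  rewrite /schro_table ?oppr0 ?opprK //.
rewrite [kron K k k']kronC [kron K j j']kronC.
rewrite (schro_sC j k') (schro_sC k j') (schro_sC j' j) (schro_sC k' k).
by apply: schro_evalP => a; rewrite !schro_evalE; ring.
Qed.

Lemma schro_tablexx a : schro_table K a a = 0.
Proof.
case: a => [||||i|i|[[j k] h]] //=.
rewrite !schro_sjj [kron K j k]kronC (schro_sC j k).
by apply: schro_evalP => a; rewrite !schro_evalE; ring.
Qed.

Lemma schro_lieC u v : schro_lie u v = - schro_lie v u.
Proof.
rewrite /schro_lie exchange_big -sumrN; apply: eq_bigr => a _.
rewrite -sumrN; apply: eq_bigr => b _.
by rewrite schro_tableC scalerN mulrC.
Qed.

Lemma schro_liexx u : schro_lie u u = 0.
Proof.
rewrite (schro_sumE u).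
elim/big_rec: _ => [|a v _ hv]; first exact: schro_lie0l.
rewrite schro_lieDl !schro_lieDr hv addr0 [X in _ + X]schro_lieC.
rewrite addrK schro_lieZl schro_lieZr schro_lie_basis schro_tablexx.
by rewrite !scaler0.
Qed.

Definition schro_lieE :=
  (schro_lieDl, schro_lieDr, schro_lieNl, schro_lieNr, schro_lieZl, schro_lieZr,
   schro_lie0l, schro_lie0r).

Lemma schro_lie_s0 a j k :
  match a with Ie | If | Ih | Iz => true | _ => false end ->
  schro_lie (schro_basis K a) (schro_s j k) = 0.
Proof.
move=> ha; move: j k; apply: (schro_s_cases (P := fun u _ _ =>
  schro_lie (schro_basis K a) u = 0)) => [j k h|u _ _ hu|_].
- by rewrite schro_lie_basis; case: a ha.
- by rewrite schro_lieNr hu oppr0.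
- by rewrite schro_lie0r.
Qed.

Lemma schro_lie_0s a j k :
  match a with Ie | If | Ih | Iz => true | _ => false end ->
  schro_lie (schro_s j k) (schro_basis K a) = 0.
Proof. by move=> ha; rewrite schro_lieC schro_lie_s0 ?oppr0. Qed.

Let gval := schro_gen_val (schro_e : schrodinger K n) schro_f schro_h schro_z
  schro_x schro_y schro_s.

Lemma schro_lie_gen g g' :
  schro_lie (gval g) (gval g')
  = schro_gen_br (kron K) schro_e schro_f schro_h schro_z
      schro_x schro_y schro_s g g'.
Proof.
case: g => [||||i|i|j k]; case: g' => [||||i'|i'|j' k'];
  rewrite /schro_gen_br /gval /schro_gen_val;
  first [exact: schro_lie_basis | exact: schro_lie_sx | exact: schro_lie_sy
        | exact: schro_lie_ss | exact: schro_lie_s0 | exact: schro_lie_0s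
        | by rewrite schro_lieC; first [rewrite schro_lie_sx | rewrite schro_lie_sy]].
Qed.

Lemma schro_gval a : {g | schro_basis K a = gval g}.
Proof.
case: a => [||||i|i|[[j k] h]];
  [exists (Ge _)|exists (Gf _)|exists (Gh _)|exists (Gz _)
  |exists (Gx i)|exists (Gy i)|exists (Gs j k)] => //.
exact: schro_lt_s.
Qed.

Let jac u v w := schro_jac (@schro_lie K n) u v w.

Let jac_basis a b c :
  jac (schro_basis K a) (schro_basis K b) (schro_basis K c) = 0.
Proof.
have [ga ->] := schro_gval a; have [gb ->] := schro_gval b.
have [gc ->] := schro_gval c.
apply: schro_evalP => t; rewrite schro_eval0.
apply: (@schro_gen_jacobi K (schrodinger K n) 'I_n (kron K) (@schro_lie K n)
  schro_e schro_f schro_h schro_z schro_x schro_y schro_s _ _ _ _ _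
  ga gb gc (fun u => u t)).
- exact: kronC.
- exact: schro_sC.
- by move=> u v w; rewrite schro_lieDr.
- by move=> k u v; rewrite schro_lieZr.
- exact: schro_lie_gen.
- exact: schro_lieC.
- by move=> u v; rewrite schro_evalD.
- by move=> k u; rewrite schro_evalZ.
Qed.

Let jacR u v w : jac u v w = jac v w u.
Proof. by rewrite /jac /schro_jac [RHS]addrC addrA. Qed.

Let jac_lin u v : (forall a, jac u v (schro_basis K a) = 0) ->
  forall w, jac u v w = 0.
Proof.
move=> h w; rewrite (schro_sumE w).
elim/big_rec: _ => [|a w' _ hw].
  by rewrite /jac /schro_jac !(schro_lie0l, schro_lie0r) !addr0.
suff -> : jac u v (w a *: schro_basis K a + w')
    = w a *: jac u v (schro_basis K a) + jac u v w'.
  by rewrite h hw scaler0 addr0.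
rewrite /jac /schro_jac !schro_lieE !scalerDr.
by rewrite [X in X + _ = _]addrACA [LHS]addrACA.
Qed.

Lemma schro_jacobi u v w :
  schro_lie u (schro_lie v w) + schro_lie v (schro_lie w u)
  + schro_lie w (schro_lie u v) = 0.
Proof.
apply: jac_lin => c; rewrite jacR; move: u.
apply: jac_lin => a; rewrite jacR; move: v.
apply: jac_lin => b.
by rewrite jac_basis.
Qed.

HB.instance Definition _ := isLieAlgebra.Build K (schrodinger K n)
  schro_lie_linearl schro_lie_linearr schro_liexx schro_jacobi.

End SchrodingerLie.

Definition schro_s12 : schro_idx 2 := Is (exist _ (0, 1) isT).

Definition schro_Re_fun (K : fieldType) (u : schrodinger K 2) :
  schrodinger K 2 := (u schro_s12 : K) *: schro_z.

Fact schro_Re_linear (K : fieldType) : linear (@schro_Re_fun K).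
Proof.
by move=> c u v; rewrite /schro_Re_fun schro_evalD schro_evalZ scalerDl scalerA.
Qed.

HB.instance Definition _ (K : fieldType) := GRing.isLinear.Build K
  (schrodinger K 2) (schrodinger K 2) *:%R (@schro_Re_fun K)
  (@schro_Re_linear K).

Definition schro_Re (K : fieldType) : 'End(schrodinger K 2) :=
  linfun (@schro_Re_fun K).

Lemma schro_Re_s12 (K : fieldType) : schro_Re K (schro_s 0 1) = schro_z.
Proof.
rewrite -(schro_lt_s K (j := 0) (k := 1) isT) lfunE /= /schro_Re_fun.
by rewrite ffunE eqxx scale1r.
Qed.

Lemma schro_Re_eq0 (K : fieldType) (a : schro_idx 2) :
  a != schro_s12 -> schro_Re K (schro_basis K a) = 0.
Proof.
move=> na; rewrite lfunE /= /schro_Re_fun ffunE eq_sym (negPf na).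
exact: scale0r.
Qed.

(* delta_{2n} Re: Re itself is only defined for n = 2. *)
Definition schro_delta_Re (K : fieldType) (n : nat) :
    'End(schrodinger K n) :=
  match n return 'End(schrodinger K n) with
  | 2 => schro_Re K
  | _ => 0
  end.

(* Main.v *)
Require Import Defs.
From HB Require Import structures.
From mathcomp Require Import all_boot all_order all_algebra.
From mathcomp Require Import all_reals.
From mathcomp Require Import complex.
From mathcomp Require Import ring.

Set Implicit Arguments.
Unset Strict Implicit.
Unset Printing Implicit Defensive.

Import GRing.Theory.
Local Open Scope ring_scope.

(** A 1/2-derivation phi is controlled by its value on h.  Since
    2 phi([h, u]) = [phi h, u] + [h, phi u], the weight components of phi e and
    phi f are determined by those of phi h; feeding them into
    2 phi(h) = [phi e, f] + [e, phi f] gives, weight by weight, an equation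
    m t = 0 with m = 2, 3 or 5 for every coordinate t of phi h other than the
    coordinate along h itself.  Hence phi h = theta h (half_der_h), and
    phi - theta id is again a 1/2-derivation, now killing h.

    A 1/2-derivation that kills h satisfies [h, phi u] = 2 phi([h, u]): it
    doubles the weight (half_der_weight).  As the weights lie in {-2, ..., 2},
    it kills e and f, sends x_i to a multiple of e and y_i to a multiple of f.
    The relations y_i = [f, x_i] and x_i = [e, y_i] turn these multiples into
    h-coordinates of phi y_i and phi x_i, which vanish, so x_i, y_i and
    z = [x_i, y_i] are killed as well.

    What remains is the weight zero image phi(s_jk).  Bracketing with e removes
    its h-coordinate and bracketing with the x_m removes its rotation part, so
    phi(s_jk) is a multiple of the central element z (half_der_s_z).  For n > 2
    every s_jk is a bracket [s_jl, s_lk], and phi kills it because z is central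
    (half_der_s0).  For n = 1 there is no s_jk.  For n = 2 the single s_12 is
    linearly independent of the derived algebra (schro2_derived_s12), which is
    exactly what makes Re, with its values in the centre, a 1/2-derivation. *)

(** * Coordinates and the adjoint action of the generators *)

(** Coordinates and basis vectors are sealed: otherwise comparing two of them by
    unification unfolds the enumeration of the index type. *)
HB.lock Definition scoord (K : fieldType) (n : nat) (a : schro_idx n)
  (v : schrodinger K n) : K := v a.

HB.lock Definition gen (K : fieldType) (n : nat) (a : schro_idx n)
  : schrodinger K n := schro_basis K a.

Section Coordinates.
Variables (K : fieldType) (n : nat).
Implicit Types (u v : schrodinger K n) (a b c : schro_idx n).

Lemma scoordE a v : scoord a v = v a.
Proof. by rewrite scoord.unlock. Qed.

Lemma scoordP u v : (forall a, scoord a u = scoord a v) -> u = v.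
Proof. by move=> h; apply: schro_evalP => a; rewrite -!scoordE. Qed.

Lemma scoordD a u v : scoord a (u + v) = scoord a u + scoord a v.
Proof. by rewrite !scoordE schro_evalD. Qed.

Lemma scoordN a v : scoord a (- v) = - scoord a v.
Proof. by rewrite !scoordE schro_evalN. Qed.

Lemma scoordZ a (k : K) v : scoord a (k *: v) = k * scoord a v.
Proof. by rewrite !scoordE schro_evalZ. Qed.

Lemma scoord0 a : scoord a (0 : schrodinger K n) = 0.
Proof. by rewrite scoordE schro_eval0. Qed.

Lemma scoord_basis a b : scoord b (schro_basis K a) = (b == a)%:R.
Proof. by rewrite scoordE ffunE. Qed.

Lemma genE a : gen K a = schro_basis K a.
Proof. by rewrite gen.unlock. Qed.

Lemma scoord_gen a b : scoord b (gen K a) = (b == a)%:R.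
Proof. by rewrite genE scoord_basis. Qed.

Lemma lie_basis_sum a v c :
  scoord c (schro_lie (schro_basis K a) v)
  = \sum_b scoord b v * scoord c (schro_table K a b).
Proof.
rewrite {1}(schro_sumE v) /=.
pose g w := scoord c (schro_lie (schro_basis K a) w).
have gD : {morph g : w w' / w + w'}.
  by move=> w w'; rewrite /g schro_lieDr scoordD.
have g0 : g 0 = 0 by rewrite /g schro_lie0r scoord0.
rewrite -/(g _) (big_morph g gD g0); apply: eq_bigr => b _.
by rewrite /g schro_lieZr scoordZ schro_lie_basis [scoord b v]scoordE.
Qed.

(** For e, f and h, and for the coordinate of ad x_m used below, at most one
    basis vector b0 contributes to a given coordinate of the bracket. *)
Lemma lie_basis_coord a v c b0 :
  (forall b, b != b0 -> scoord c (schro_table K a b) = 0) ->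
  scoord c (schro_lie (schro_basis K a) v)
  = scoord b0 v * scoord c (schro_table K a b0).
Proof.
move=> h; rewrite lie_basis_sum; apply: big_only1 => // b nb _.
by rewrite h // mulr0.
Qed.

Ltac compute_coord :=
  rewrite /schro_table /schro_e /schro_f /schro_h /schro_z /schro_x /schro_y
    ?(scoordD, scoordN, scoordZ, scoord0, scoord_basis) /kron;
  repeat match goal with
  | |- context [?a == ?b :> schro_idx _] =>
      first [ have -> : (a == b) = true by rewrite ?eqxx
            | have -> : (a == b) = false by apply/eqP ]
  end.

Lemma lie_e_coord v a : scoord a (schro_lie (gen K Ie) v) = match a with
  | Ie => - 2 * scoord Ih v | Ih => scoord If v
  | Ix i => scoord (Iy i) v | _ => 0 end.
Proof.
(* In the coordinates where nothing contributes, Iz is an arbitrary choice. *)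
rewrite genE (@lie_basis_coord _ _ _
  (match a with Ie => Ih | Ih => If | Ix i => Iy i | _ => Iz end)).
  by case: a => [||||i|i|p]; compute_coord => //=; ring.
case: a => [||||i|i|p]; case=> [||||l|l|[[l m] hl]] //= nb; compute_coord;
  rewrite ?mulr0 ?oppr0 //; try by rewrite eqxx in nb.
by move: nb; rewrite eq_sym -[_ == _]/(Ix i == Ix l) => /negPf ->.
Qed.

Lemma lie_f_coord v a : scoord a (schro_lie (gen K If) v) = match a with
  | If => 2 * scoord Ih v | Ih => - scoord Ie v
  | Iy i => scoord (Ix i) v | _ => 0 end.
Proof.
rewrite genE (@lie_basis_coord _ _ _
  (match a with If => Ih | Ih => Ie | Iy i => Ix i | _ => Iz end)).
  by case: a => [||||i|i|p]; compute_coord => //=; ring.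
case: a => [||||i|i|p]; case=> [||||l|l|[[l m] hl]] //= nb; compute_coord;
  rewrite ?mulr0 ?oppr0 //; try by rewrite eqxx in nb.
by move: nb; rewrite eq_sym -[_ == _]/(Iy i == Iy l) => /negPf ->.
Qed.

(** The eigenvalue of ad h. *)
Definition wt a : int :=
  match a with Ie => 2 | If => - 2 | Ix _ => 1 | Iy _ => - 1 | _ => 0 end.

Lemma lie_h_coord v a :
  scoord a (schro_lie (gen K Ih) v) = (wt a)%:~R * scoord a v.
Proof.
rewrite genE (@lie_basis_coord _ _ _ a).
  by case: a => [||||i|i|p]; compute_coord => //=; ring.
move=> b; rewrite eq_sym => nb.
case: b nb => [||||l|l|[[l m] hl]] /negPf nb; rewrite /= /schro_e /schro_f
  /schro_x /schro_y ?(scoordN, scoordZ, scoord0, scoord_basis) ?nb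
  ?mulr0 ?oppr0 //.
Qed.

(** The x-coordinates of [x_m, v] recover the rotation part of v. *)
Lemma lie_x_coord (l m : 'I_n) (h : (l < m)%N) v :
  scoord (Ix l) (schro_lie (gen K (Ix m)) v)
  = - scoord (Is (exist _ (l, m) h)) v.
Proof.
have /negPf nlm : l != m by rewrite -val_eqE neq_ltn h.
have Ex i j : (Ix i == Ix j :> schro_idx n) = (i == j) by [].
rewrite genE (@lie_basis_coord _ _ _ (Is (exist _ (l, m) h))).
  by compute_coord; rewrite nlm /=; ring.
case=> [||||i|i|[[j k] hjk]] nb; compute_coord;
  rewrite ?Ex ?nlm ?mulr0 ?oppr0 //.
rewrite -!natrM !mulnb.
(* j < k and l < m exclude the transposed pair. *)
have -> : (j == m) && (l == k) = false.
  apply/andP=> -[/eqP Ejm /eqP Elk]; have := hjk.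
  by rewrite /= Ejm -Elk ltnNge ltnW.
have : (j == l) && (k == m) = false by apply/negbTE; exact: nb.
by rewrite [l == j]eq_sym andbC => ->; rewrite subrr oppr0.
Qed.

Lemma lie_fx i : schro_lie (gen K If) (gen K (Ix i))
  = gen K (Iy i) :> schrodinger K n.
Proof. by rewrite !genE schro_lie_basis. Qed.

Lemma lie_ey i : schro_lie (gen K Ie) (gen K (Iy i))
  = gen K (Ix i) :> schrodinger K n.
Proof. by rewrite !genE schro_lie_basis. Qed.

Lemma lie_xy i j : schro_lie (gen K (Ix i)) (gen K (Iy j))
  = (i == j)%:R *: gen K Iz :> schrodinger K n.
Proof. by rewrite !genE schro_lie_basis. Qed.

Lemma lie_he : schro_lie (gen K Ih) (gen K Ie)
  = 2 *: gen K Ie :> schrodinger K n.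
Proof. by rewrite !genE schro_lie_basis. Qed.

Lemma lie_hf : schro_lie (gen K Ih) (gen K If)
  = - (2 *: gen K If) :> schrodinger K n.
Proof. by rewrite !genE schro_lie_basis. Qed.

Lemma lie_ef : schro_lie (gen K Ie) (gen K If)
  = gen K Ih :> schrodinger K n.
Proof. by rewrite !genE schro_lie_basis. Qed.

Lemma lie_es p : schro_lie (gen K Ie) (gen K (Is p)) = 0 :> schrodinger K n.
Proof. by rewrite !genE schro_lie_basis. Qed.

Lemma lie_xs i p : schro_lie (gen K (Ix i)) (gen K (Is p))
  = ((val p).1 == i)%:R *: gen K (Ix (val p).2)
    - ((val p).2 == i)%:R *: gen K (Ix (val p).1) :> schrodinger K n.
Proof.
by rewrite !genE schro_lie_basis; case: p => -[j k] h /=; rewrite opprB.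
Qed.

Lemma lie_z v : schro_lie (gen K Iz) v = 0.
Proof.
apply: scoordP => a; rewrite genE lie_basis_sum scoord0 big1 // => b _.
by rewrite mulr0.
Qed.

Lemma lie_vz v : schro_lie v (gen K Iz) = 0.
Proof. by rewrite schro_lieC lie_z oppr0. Qed.

Lemma lfun_basisP (phi psi : 'End(schrodinger K n)) :
  (forall a, phi (schro_basis K a) = psi (schro_basis K a)) -> phi = psi.
Proof.
move=> eq_basis; apply/lfunP => u; rewrite (schro_sumE u) !linear_sum.
by apply: eq_bigr => a _; rewrite !linearZ /= eq_basis.
Qed.

End Coordinates.

(** * 1/2-derivations on the generators *)

Section HalfDerivation.
Variables (K : fieldType) (n : nat).
Hypothesis charK : [pchar K]%R =i pred0.

Lemma natr_mul_eq0 m (x : K) : m.+1%:R * x = 0 -> x = 0.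
Proof.
by move=> /eqP; rewrite mulf_eq0; have /pcharf0P -> := charK => /eqP.
Qed.

Lemma intr_mul_eq0 (m : int) (x : K) : m != 0 -> m%:~R * x = 0 -> x = 0.
Proof.
case: m => [[|m]|m] // _; first exact: natr_mul_eq0.
rewrite NegzE mulrNz mulNr => /eqP; rewrite oppr_eq0 => /eqP.
exact: natr_mul_eq0.
Qed.

Lemma lincomb_eq0 m (p q a b c d x : K) : a = b -> c = d ->
  m.+1%:R * x = p * (a - b) + q * (c - d) -> x = 0.
Proof. by move=> -> ->; rewrite !subrr !mulr0 addr0 => /natr_mul_eq0. Qed.

Variable phi : {linear schrodinger K n -> schrodinger K n}.
Hypothesis phiP : forall u v,
  phi (schro_lie u v) *+ 2 = schro_lie (phi u) v + schro_lie u (phi v).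

(** Antisymmetry puts both brackets in the form ad u, ad v, whose coordinates
    are known. *)
Lemma half_der_coord u v a :
  2 * scoord a (phi (schro_lie u v))
  = scoord a (schro_lie u (phi v)) - scoord a (schro_lie v (phi u)).
Proof.
rewrite -scoordZ scaler_nat phiP addrC scoordD.
by rewrite [schro_lie (phi u) v]schro_lieC scoordN.
Qed.

(** The equations he and hf express phi e and phi f through phi h, and ef is
    the relation [e, f] = h.  In the coordinates along z and s_jk, ef alone
    gives 2 t = 0; in the others off h, ef and one of he, hf form a nonsingular
    2 by 2 system. *)
Lemma half_der_h : phi (gen K Ih) = scoord Ih (phi (gen K Ih)) *: gen K Ih.
Proof.
have he a : 4 * scoord a (phi (gen K Ie))
    = (wt a)%:~R * scoord a (phi (gen K Ie))
    - scoord a (schro_lie (gen K Ie) (phi (gen K Ih))).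
  have := half_der_coord (gen K Ih) (gen K Ie) a.
  by rewrite lie_h_coord lie_he linearZ scoordZ => <-; ring.
have hf a : - 4 * scoord a (phi (gen K If))
    = (wt a)%:~R * scoord a (phi (gen K If))
    - scoord a (schro_lie (gen K If) (phi (gen K Ih))).
  have := half_der_coord (gen K Ih) (gen K If) a.
  by rewrite lie_h_coord lie_hf linearN linearZ scoordN scoordZ => <-; ring.
have ef a : 2 * scoord a (phi (gen K Ih))
    = scoord a (schro_lie (gen K Ie) (phi (gen K If)))
      - scoord a (schro_lie (gen K If) (phi (gen K Ie))).
  by have := half_der_coord (gen K Ie) (gen K If) a; rewrite lie_ef.
apply: scoordP => a; rewrite scoordZ scoord_gen.
have [->|/eqP na] := eqVneq a Ih; first by rewrite mulr1.
(* The coefficients p and q eliminate the coordinate of phi e or phi f. *)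
rewrite mulr0; case: a na => [||||i|i|p] // _.
- have := hf Ih; have := ef Ie; rewrite lie_e_coord !lie_f_coord /= => E1 E2.
  by apply: (lincomb_eq0 (m := 2) (p := 2) (q := 1) E1 E2); ring.
- have := he Ih; have := ef If; rewrite !lie_e_coord lie_f_coord /= => E1 E2.
  by apply: (lincomb_eq0 (m := 2) (p := 2) (q := - 1) E1 E2); ring.
- have := ef Iz; rewrite lie_e_coord lie_f_coord subr0; exact: natr_mul_eq0.
- have := hf (Iy i); have := ef (Ix i).
  rewrite lie_e_coord !lie_f_coord /= => E1 E2.
  by apply: (lincomb_eq0 (m := 4) (p := 3) (q := - 1) E1 E2); ring.
- have := he (Ix i); have := ef (Iy i).
  rewrite !lie_e_coord lie_f_coord /= => E1 E2.
  by apply: (lincomb_eq0 (m := 4) (p := 3) (q := - 1) E1 E2); ring.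
- by have := ef (Is p); rewrite lie_e_coord lie_f_coord subr0 => /natr_mul_eq0.
Qed.

Section KillsH.
Hypothesis phi_h0 : phi (gen K Ih) = 0.

(** Once phi h = 0, the identity for the pair (h, u) reads
    [h, phi u] = 2 phi([h, u]), so phi doubles the weight. *)
Lemma half_der_weight a b : wt b != 2 * wt a ->
  scoord b (phi (gen K a)) = 0.
Proof.
move=> nab; apply: (@intr_mul_eq0 (wt b - 2 * wt a)); first by rewrite subr_eq0.
have := half_der_coord (gen K Ih) (gen K a) b.
have -> : schro_lie (gen K Ih) (gen K a) = (wt a)%:~R *: gen K a.
  apply: scoordP => c; rewrite lie_h_coord scoordZ scoord_gen.
  by have [->|] := eqVneq c a; rewrite ?mulr0.
rewrite phi_h0 schro_lie0r scoord0 subr0 lie_h_coord linearZ scoordZ => E.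
by rewrite rmorphB rmorphM /= mulrBl -E; ring.
Qed.

(** Weights 4 and -4 do not occur. *)
Lemma half_der_e0 : phi (gen K Ie) = 0.
Proof.
by apply: scoordP => -[||||i|i|p]; rewrite scoord0 half_der_weight.
Qed.

Lemma half_der_f0 : phi (gen K If) = 0.
Proof.
by apply: scoordP => -[||||i|i|p]; rewrite scoord0 half_der_weight.
Qed.

(** By weight phi(x_i) = c e.  Taking the h-coordinate in
    2 phi(y_i) = [f, phi(x_i)] = - c h, where phi(y_i) has weight -2, gives
    c = 0. *)
Lemma half_der_x0 i : phi (gen K (Ix i)) = 0.
Proof.
apply: scoordP => b; rewrite scoord0.
case: b => [||||j|j|p]; try by rewrite half_der_weight.
have := half_der_coord (gen K If) (gen K (Ix i)) Ih.
rewrite half_der_f0 schro_lie0r scoord0 subr0 lie_fx lie_f_coord.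
by rewrite half_der_weight // mulr0 => /esym/eqP; rewrite oppr_eq0 => /eqP.
Qed.

Lemma half_der_y0 i : phi (gen K (Iy i)) = 0.
Proof.
apply: scoordP => b; rewrite scoord0.
case: b => [||||j|j|p]; try by rewrite half_der_weight.
have := half_der_coord (gen K Ie) (gen K (Iy i)) Ih.
rewrite half_der_e0 schro_lie0r scoord0 subr0 lie_ey lie_e_coord.
by rewrite half_der_weight // mulr0.
Qed.

Lemma half_der_z0 : (0 < n)%N -> phi (gen K Iz) = 0.
Proof.
move=> n_gt0; pose i := Ordinal n_gt0.
apply: scoordP => a; rewrite scoord0; apply: (@natr_mul_eq0 1).
have := half_der_coord (gen K (Ix i)) (gen K (Iy i)) a.
by rewrite lie_xy eqxx scale1r half_der_x0 half_der_y0 !schro_lie0r subrr.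
Qed.

(** By weight phi(s_jk) lies in the span of h, z and the s_lm.  It commutes
    with e and with all x_m, since these are killed and [e, s_jk] = 0 while
    [x_m, s_jk] is a combination of x's; only z survives. *)
Lemma half_der_s_z j k :
  phi (schro_s j k) = scoord Iz (phi (schro_s j k)) *: gen K Iz.
Proof.
suff [c ->] : exists c : K, phi (schro_s j k) = c *: gen K Iz.
  by rewrite scoordZ scoord_gen eqxx mulr1.
move: j k; apply: (schro_s_cases (P := fun u _ _ =>
  exists c : K, phi u = c *: gen K Iz)) => [j k h|u _ _ [c hc]|_]; last first.
- by exists 0; rewrite linear0 scale0r.
- by exists (- c); rewrite linearN /= hc scaleNr.
rewrite -genE; set p := exist _ _ _; exists (scoord Iz (phi (gen K (Is p)))).
apply: scoordP => b; rewrite scoordZ scoord_gen.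
have [->|/eqP nb] := eqVneq b Iz; first by rewrite mulr1.
rewrite mulr0; case: b nb => [||||i|i|[[l m] hlm]] // _;
  try by rewrite half_der_weight.
- have := half_der_coord (gen K Ie) (gen K (Is p)) Ie.
  rewrite lie_es linear0 half_der_e0 schro_lie0r scoord0 mulr0 subr0.
  rewrite lie_e_coord mulNr => /esym/eqP.
  by rewrite oppr_eq0 => /eqP/natr_mul_eq0.
have := half_der_coord (gen K (Ix m)) (gen K (Is p)) (Ix l).
rewrite lie_xs linearB !linearZ /= !half_der_x0 !(scaler0, oppr0, addr0).
rewrite schro_lie0r !scoord0 subr0 mulr0 lie_x_coord => /esym/eqP.
by rewrite oppr_eq0 => /eqP.
Qed.

(** A third index l makes s_jk = [s_jl, s_lk] a bracket of two elements whose
    images are central. *)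
Lemma half_der_s0 j k : (2 < n)%N -> phi (schro_s j k) = 0.
Proof.
move=> n_gt2; have [->|njk] := eqVneq j k; first by rewrite schro_sjj linear0.
have [l] : exists l : 'I_n, l \in ~: [set j; k].
  apply/card_gt0P; rewrite cardsCs setCK card_ord cards2 njk.
  by rewrite subn_gt0.
rewrite !inE => /norP[nlj nlk].
have -> : schro_s j k = schro_lie (schro_s j l) (schro_s l k)
    :> schrodinger K n.
  rewrite schro_lie_ss /kron eqxx [k == l]eq_sym (negPf njk) (negPf nlj).
  by rewrite (negPf nlk) scale1r !scale0r !addr0.
apply: scoordP => a; rewrite scoord0; apply: (@natr_mul_eq0 1).
rewrite half_der_coord half_der_s_z [phi (schro_s j l)]half_der_s_z.
by rewrite !schro_lieZr !lie_vz !scaler0 subrr.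
Qed.

Lemma half_der_not_s a : (0 < n)%N -> (forall p, a <> Is p) ->
  phi (gen K a) = 0.
Proof.
move=> n_gt0; case: a => [||||i|i|p] ns.
- exact: half_der_e0.
- exact: half_der_f0.
- exact: phi_h0.
- exact: half_der_z0.
- exact: half_der_x0.
- exact: half_der_y0.
- by case: (ns p).
Qed.

End KillsH.
End HalfDerivation.

(** * The exceptional map for n = 2 *)

Lemma so2_idx (p : {p : 'I_2 * 'I_2 | (p.1 < p.2)%N}) :
  Is p = schro_s12 :> schro_idx 2.
Proof.
case: p => -[[j hj] [k hk]] h; congr Is; apply: val_inj.
by case: j k hj hk h => [|j] [|[|k]] //= hj hk h; congr pair; apply: val_inj.
Qed.

(** so(2) is abelian and the remaining generators span an ideal, so s_12 never
    occurs in a bracket. *)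
Lemma schro2_derived_s12 (K : fieldType) (u v : schrodinger K 2) :
  schro_lie u v schro_s12 = 0 :> K.
Proof.
rewrite -scoordE /schro_lie.
have scoord_sum I r (F : I -> schrodinger K 2) :
    scoord schro_s12 (\sum_(i <- r) F i) = \sum_(i <- r) scoord schro_s12 (F i).
  by apply: big_morph => [w w'|]; rewrite ?scoordD ?scoord0.
rewrite scoord_sum big1 // => a _; rewrite scoord_sum big1 // => b _.
rewrite scoordZ; suff -> : scoord schro_s12 (schro_table K a b) = 0.
  by rewrite mulr0.
have ns c : (forall p, c <> Is p) -> scoord schro_s12 (gen K c) = 0.
  by move=> nc; rewrite scoord_gen; case: eqP => // /esym/nc.
case: a => [||||i|i|p]; case: b => [||||j|j|q]; last first.
  by rewrite !so2_idx schro_tablexx scoord0.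
all: try case: p => -[k l] hkl; try case: q => -[k l] hkl.
all: rewrite /schro_table /schro_e /schro_f /schro_h /schro_z /schro_x /schro_y.
all: rewrite -?genE.
all: by rewrite ?(scoordD, scoordN, scoordZ, scoord0) ?ns //
  ?(mulr0, oppr0, addr0).
Qed.

Lemma half_derivation_id (K : fieldType) (L : lieAlgebraType K) :
  2%:R != 0 :> K -> half_derivation (\1%VF : 'End(L)).
Proof.
move=> nz2 u v; rewrite !id_lfunE -mulr2n -scaler_nat scalerA.
by rewrite mulVf ?scale1r.
Qed.

Lemma half_derivation_delta_Re (K : fieldType) n :
  half_derivation (schro_delta_Re K n).
Proof.
have half0 m : half_derivation (0 : 'End(schrodinger K m)).
  move=> u v; rewrite !zero_lfunE -[lie 0 v]/(schro_lie 0 v).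
  by rewrite -[lie u 0]/(schro_lie u 0) schro_lie0l schro_lie0r addr0 scaler0.
case: n => [|[|[|m]]] //= u v.
have ReE w : schro_Re K w = w schro_s12 *: gen K Iz by rewrite lfunE genE.
rewrite !ReE schro2_derived_s12 scale0r.
rewrite -[lie _ v]/(schro_lie _ v) -[lie u _]/(schro_lie u _).
by rewrite schro_lieZl schro_lieZr lie_z lie_vz !(scaler0, addr0).
Qed.

(** * Classification *)

Section Classification.
Variables (K : fieldType) (n : nat).
Hypothesis charK : [pchar K]%R =i pred0.

Let nz2 : 2%:R != 0 :> K.
Proof. by have /pcharf0P -> := charK. Qed.

Lemma half_derE (phi : 'End(schrodinger K n)) : half_derivation phi ->
  forall u v, phi (schro_lie u v) *+ 2
    = schro_lie (phi u) v + schro_lie u (phi v).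
Proof.
move=> phiP u v; rewrite -[schro_lie u v]/(lie u v) phiP -scaler_nat scalerA.
by rewrite divff ?scale1r.
Qed.

Lemma half_der_kills_h (psi : 'End(schrodinger K n)) :
  (0 < n)%N -> half_derivation psi -> psi (gen K Ih) = 0 ->
  exists beta : K, psi = beta *: schro_delta_Re K n.
Proof.
move=> n_gt0 /half_derE psiP psi_h.
have ns := half_der_not_s charK psiP psi_h n_gt0.
case: n psi psiP psi_h ns n_gt0 => [|[|[|m]]] // psi psiP psi_h ns _.
- exists 0; rewrite scale0r; apply: lfun_basisP => a.
  rewrite zero_lfunE -genE ns // => p.
  by case: p => -[[[|j] hj] [[|k] hk]].
- exists (scoord Iz (psi (schro_s 0 1))); apply: lfun_basisP => a.
  rewrite scale_lfunE; have [->|na] := eqVneq a schro_s12.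
    rewrite (schro_lt_s K (j := 0) (k := 1) isT) schro_Re_s12 -[schro_z]genE.
    exact: (half_der_s_z charK psiP).
  rewrite schro_Re_eq0 // scaler0 -genE ns // => p Ea.
  by rewrite Ea so2_idx eqxx in na.
exists 0; rewrite scale0r; apply: lfun_basisP => a; rewrite zero_lfunE -genE.
case: a => [||||i|i|[[j k] hjk]]; try by rewrite ns.
by rewrite genE schro_lt_s (half_der_s0 charK psiP).
Qed.

(** Subtracting the h-eigenvalue of phi reduces to the case phi h = 0. *)
Lemma half_derivation_classification (phi : 'End(schrodinger K n)) :
  (0 < n)%N -> half_derivation phi ->
  exists theta beta : K, phi = theta *: \1%VF + beta *: schro_delta_Re K n.
Proof.
move=> n_gt0 phiP; pose theta := scoord Ih (phi (gen K Ih)).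
have [||beta psiE] := @half_der_kills_h (phi - theta *: \1%VF) n_gt0.
- apply/half_derivationsP; rewrite memvB ?memvZ //;
    apply/half_derivationsP => //.
  exact: half_derivation_id.
- rewrite add_lfunE opp_lfunE scale_lfunE id_lfunE.
  by rewrite {1}(half_der_h charK (half_derE phiP)) subrr.
by exists theta, beta; rewrite -psiE addrC subrK.
Qed.

Lemma half_derivations_span : (0 < n)%N ->
  half_derivations (schrodinger K n) = <<[:: \1%VF; schro_delta_Re K n]>>%VS.
Proof.
move=> n_gt0; apply/eqP; rewrite eqEsubv; apply/andP; split.
  apply/subvP => phi /half_derivationsP.
  move=> /(half_derivation_classification n_gt0)[theta [beta ->]].
  by rewrite memvD // memvZ // memv_span // !inE eqxx ?orbT.
apply/span_subvP => phi; rewrite !inE => /orP[] /eqP ->.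
  by apply/half_derivationsP; exact: half_derivation_id.
by apply/half_derivationsP; exact: half_derivation_delta_Re.
Qed.

End Classification.

Lemma id_lfun_neq0 (K : fieldType) n : \1%VF != 0 :> 'End(schrodinger K n).
Proof.
apply/eqP => /lfunP/(_ schro_z); rewrite id_lfunE zero_lfunE.
move=> /(congr1 (scoord Iz)); rewrite scoord_basis scoord0 eqxx => /eqP.
by rewrite oner_eq0.
Qed.

Lemma delta_Re_eq0 (K : fieldType) n : n <> 2 -> schro_delta_Re K n = 0.
Proof. by case: n => [|[|[|n]]]. Qed.

Lemma free_id_Re (K : fieldType) : free [:: \1%VF; schro_Re K].
Proof.
rewrite free_cons seq1_free span_seq1; apply/andP; split; last first.
  apply/eqP => Re0; have := schro_Re_s12 K; rewrite Re0 zero_lfunE.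
  move=> /(congr1 (scoord Iz)); rewrite scoord_basis scoord0 eqxx => /eqP.
  by rewrite eq_sym oner_eq0.
apply/vlineP => -[c] /lfunP/(_ schro_z); rewrite id_lfunE scale_lfunE.
rewrite schro_Re_eq0 // scaler0 => /(congr1 (scoord Iz)).
by rewrite scoord_basis scoord0 eqxx => /eqP; rewrite oner_eq0.
Qed.

Theorem theorem3p6 (R : realType) (n : nat) (hn : (1 <= n)%N) :
  [/\ forall phi : 'End(schrodinger R[i] n),
        half_derivation phi ->
        exists theta beta : R[i],
          phi = theta *: \1%VF + beta *: schro_delta_Re R[i] n,
      half_derivations (schrodinger R[i] n)
        = <<[:: \1%VF; schro_delta_Re R[i] n]>>%VS,
      n <> 2%N -> \dim (half_derivations (schrodinger R[i] n)) = 1%N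
    & \dim (half_derivations (schrodinger R[i] 2)) = 2%N].
Proof.
have charRi := Num.Theory.pchar_num R[i].
split; [|exact: half_derivations_span| |].
- by move=> phi; exact: half_derivation_classification.
- move=> n2; rewrite half_derivations_span // (delta_Re_eq0 _ n2).
  by rewrite span_cons span_seq1 addv0 dim_vline id_lfun_neq0.
by rewrite half_derivations_span //; apply/eqP/free_id_Re.
Qed.
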